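(* Let $(M,\omega)$ be a connected symplectic manifold, let $G$ be a Lie group with Lie algebra $\mathfrak{g}$ acting on $M$ by a Hamiltonian action that admits an $\mathrm{Ad}^*$-equivariant moment map $\mu:M\to\mathfrak{g}^*$, and let $L\subset G$ be a Lie subgroup with Lie algebra $\mathfrak{l}\subset\mathfrak{g}$. Let $x\in M$. Then the orbit $Lx$ is isotropic if and only if $\mu(x)$ belongs to the annihilator $(\mathfrak{l}')^{\circ}$ of the derived algebra $\mathfrak{l}'$ of $\mathfrak{l}$.
   Context: The action of $G$ on $(M,\omega)$ is Hamiltonian with moment map $\mu:M\to\mathfrak{g}^*$ if the action is by symplectomorphisms, $\mu$ is smooth, and for all $X\in\mathfrak{g}$ one has $d\hat\mu(X)=\iota_{\widetilde X}\omega$, where $\hat\mu(X)(x)=\mu(x)(X)$ and $\widetilde X(x)=\frac{d}{dt}\big|_{t=0}e^{tX}\cdot x$ is the fundamental vector field of $X$. The moment map is $\mathrm{Ad}^*$-equivariant if $\mu(g\cdot x)=\mathrm{Ad}^*(g)\mu(x)$ for all $g\in G$, $x\in M$, where $\mathrm{Ad}^*$ is the coadjoint representation, $\mathrm{Ad}^*(g)\alpha=\alpha\circ\mathrm{Ad}(g^{-1})$. The derived algebra is $\mathfrak{l}'=[\mathfrak{l},\mathfrak{l}]$ and $(\mathfrak{l}')^{\circ}=\{\alpha\in\mathfrak{g}^*:\alpha|_{\mathfrak{l}'}=0\}$. The orbit $Lx$, with tangent spaces $T_y(Lx)=\{\widetilde X(y):X\in\mathfrak{l}\}$, is isotropic if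 $\omega$ vanishes on it. *)

(* Defs.v *)
From HB Require Import structures.
From mathcomp Require Import all_boot all_order all_algebra.
From mathcomp Require Import all_classical all_reals all_analysis.

Set Implicit Arguments.
Unset Strict Implicit.
Unset Printing Implicit Defensive.

Import Order.TTheory GRing.Theory Num.Theory.
Import numFieldNormedType.Exports.
Local Open Scope classical_set_scope.
Local Open Scope ring_scope.

(* Meant for U open: only values and derivatives at points of U matter. *)
Fixpoint Ck_on (R : realType) (E F : normedModType R) (k : nat) (U : set E)
    (f : E -> F) : Prop :=
  if k is k'.+1 then
    (forall p, U p -> differentiable f p) /\
    (forall v, Ck_on k' U (fun p => 'D_v f p))
  else forall p, U p -> {for p, continuous f}.

Definition smooth_on (R : realType) (E F : normedModType R) (U : set E)
    (f : E -> F) : Prop :=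
  forall k, Ck_on k U f.

(* cfun and cinv are total functions; they are constrained only on cdom and
   on its image, between which they are mutually inverse homeomorphisms. *)
Record chart (R : realType) (n : nat) (T : topologicalType) := Chart {
  cdom : set T;
  cfun :> T -> 'rV[R]_n;
  cinv : 'rV[R]_n -> T;
  cdom_open : open cdom;
  cimg_open : open (cfun @` cdom);
  cfunK : forall x, cdom x -> cinv (cfun x) = x;
  cfun_continuous : forall x, cdom x -> {for x, continuous cfun};
  cinv_continuous : forall p, (cfun @` cdom) p -> {for p, continuous cinv}
}.

Definition cimg (R : realType) (n : nat) (T : topologicalType)
    (c : chart R n T) : set 'rV[R]_n := c @` cdom c.

(* The atlas is {chart_at x | x in M}: an atlas together with the choice, for
   each point x, of one of its charts around x. *)
HB.mixin Record isManifold (R : realType) (n : nat) M & Topological M := {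
  chart_at : M -> chart R n M;
  chart_at_dom : forall x, cdom (chart_at x) x;
  chart_at_compatible : forall x y,
    smooth_on (chart_at x @` (cdom (chart_at x) `&` cdom (chart_at y)))
              (chart_at y \o cinv (chart_at x));
  manifold_hausdorff : hausdorff_space M;
  manifold_second_countable : @second_countable M
}.

#[short(type="manifoldType")]
HB.structure Definition Manifold (R : realType) (n : nat) :=
  {M of isManifold R n M & Topological M}.

(* Tangent vectors at x are represented by their coordinates in the chart
   chart_at x, so that T_x M is 'rV[R]_n; all the definitions below follow
   this convention. *)

Section SmoothMaps.
Context {R : realType}.

Definition smooth_map {m n} {M : manifoldType R m} {N : manifoldType R n}
    (f : M -> N) : Prop :=
  continuous f /\
  forall x y, smooth_on
    (chart_at x @` (cdom (chart_at x) `&` f @^-1` cdom (chart_at y)))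
    (chart_at y \o f \o cinv (chart_at x)).

(* Smoothness of the map (a, b) |-> f a b on the product manifold A x B, in
   the product charts. *)
Definition smooth_map2 {k m n} {A : manifoldType R k} {B : manifoldType R m}
    {N : manifoldType R n} (f : A -> B -> N) : Prop :=
  continuous (fun ab : A * B => f ab.1 ab.2) /\
  forall a b y, smooth_on
    [set pq : 'rV[R]_k * 'rV[R]_m |
       [/\ cimg (chart_at a) pq.1, cimg (chart_at b) pq.2 &
           cdom (chart_at y)
             (f (cinv (chart_at a) pq.1) (cinv (chart_at b) pq.2))]]
    (fun pq => chart_at y (f (cinv (chart_at a) pq.1)
                             (cinv (chart_at b) pq.2))).

Definition smooth_fun {n} {M : manifoldType R n} {V : normedModType R}
    (f : M -> V) : Prop :=
  forall x, smooth_on (cimg (chart_at x)) (f \o cinv (chart_at x)).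

Definition smooth_curve {n} {M : manifoldType R n} (c : R -> M) : Prop :=
  continuous c /\
  forall x, smooth_on (c @^-1` cdom (chart_at x)) (chart_at x \o c).

(* T_x f : T_x M -> T_(f x) N *)
Definition tangent_map {m n} {M : manifoldType R m} {N : manifoldType R n}
    (f : M -> N) (x : M) : 'rV[R]_m -> 'rV[R]_n :=
  'd (chart_at (f x) \o f \o cinv (chart_at x)) (chart_at x x).

(* df_x : T_x M -> V *)
Definition differential {n} {M : manifoldType R n} {V : normedModType R}
    (f : M -> V) (x : M) : 'rV[R]_n -> V :=
  'd (f \o cinv (chart_at x)) (chart_at x x).

(* c'(t), in T_(c t) M *)
Definition velocity {n} {M : manifoldType R n} (c : R -> M) (t : R) :
    'rV[R]_n :=
  derive1 (chart_at (c t) \o c) t.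

(* Passage from T_y M to the coordinates of a chart c around y, and from the
   coordinates of c at the point p to T_y M with y = cinv c p. *)
Definition to_chart {n} {M : manifoldType R n} (c : chart R n M) (y : M) :
    'rV[R]_n -> 'rV[R]_n :=
  'd (c \o cinv (chart_at y)) (chart_at y y).

Definition of_chart {n} {M : manifoldType R n} (c : chart R n M)
    (p : 'rV[R]_n) : 'rV[R]_n -> 'rV[R]_n :=
  'd (chart_at (cinv c p) \o cinv c) p.

End SmoothMaps.

Section SymplecticForms.
Context {R : realType} {n : nat} {M : manifoldType R n}.

Definition chart_form (w : M -> 'rV[R]_n -> 'rV[R]_n -> R) (c : chart R n M)
    (p u v : 'rV[R]_n) : R :=
  w (cinv c p) (of_chart c p u) (of_chart c p v).

(* The exterior derivative of a 2-form, evaluated on the constant vector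
   fields u, v, s of the chart c at the point p. *)
Definition chart_extd (w : M -> 'rV[R]_n -> 'rV[R]_n -> R) (c : chart R n M)
    (p u v s : 'rV[R]_n) : R :=
  'D_u (fun q => chart_form w c q v s) p
  - 'D_v (fun q => chart_form w c q u s) p
  + 'D_s (fun q => chart_form w c q u v) p.

Record symplectic_form (w : M -> 'rV[R]_n -> 'rV[R]_n -> R) : Prop := {
  symp_linear : forall x a u u' v,
    w x (a *: u + u') v = a * w x u v + w x u' v;
  symp_antisym : forall x u v, w x u v = - w x v u;
  symp_nondegenerate : forall x u, (forall v, w x u v = 0) -> u = 0;
  symp_smooth : forall x u v,
    smooth_on (cimg (chart_at x)) (fun p => chart_form w (chart_at x) p u v);
  symp_closed : forall x p u v s,
    cimg (chart_at x) p -> chart_extd w (chart_at x) p u v s = 0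
}.

End SymplecticForms.

HB.mixin Record isLieGroup (R : realType) (n : nat) G
    & Manifold R n G & Group G := {
  smooth_mulg : smooth_map2 (fun g h : G => (g * h)%g);
  smooth_invg : smooth_map (fun g : G => g^-1%g)
}.

#[short(type="lieGroupType")]
HB.structure Definition LieGroup (R : realType) (n : nat) :=
  {G of isLieGroup R n G & Manifold R n G & Group G}.

Section LieAlgebra.
Context {R : realType} {m : nat} {G : lieGroupType R m}.

(* The Lie algebra g of G is T_1 G with the bracket of the left-invariant
   vector fields. *)

Definition left_invariant_field (X : 'rV[R]_m) (g : G) : 'rV[R]_m :=
  tangent_map (fun h : G => (g * h)%g) 1%g X.

Definition chart_field {n} {M : manifoldType R n} (V : M -> 'rV[R]_n)
    (c : chart R n M) (p : 'rV[R]_n) : 'rV[R]_n :=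
  to_chart c (cinv c p) (V (cinv c p)).

(* [V, W] = DW(V) - DV(W) in the chart chart_at x. *)
Definition field_bracket {n} {M : manifoldType R n} (V W : M -> 'rV[R]_n)
    (x : M) : 'rV[R]_n :=
  'D_(V x) (chart_field W (chart_at x)) (chart_at x x)
  - 'D_(W x) (chart_field V (chart_at x)) (chart_at x x).

Definition lie_bracket (X Y : 'rV[R]_m) : 'rV[R]_m :=
  field_bracket (left_invariant_field X) (left_invariant_field Y) (1%g : G).

Definition one_parameter_subgroup (c : R -> G) : Prop :=
  smooth_curve c /\ forall s t, c (s + t) = (c s * c t)%g.

(* This determines expG uniquely, and every Lie group has such a map: for
   each X there is exactly one one-parameter subgroup with velocity X at 0. *)
Definition exponential_map (expG : 'rV[R]_m -> G) : Prop :=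
  forall X, one_parameter_subgroup (fun t => expG (t *: X)) /\
            velocity (fun t => expG (t *: X)) 0 = X.

Definition Ad (g : G) : 'rV[R]_m -> 'rV[R]_m :=
  tangent_map (fun h : G => (g * h * g^-1)%g) 1%g.

Definition linear_span (A : set 'rV[R]_m) : set 'rV[R]_m :=
  [set Z | exists k (a : 'I_k -> R) (B : 'I_k -> 'rV[R]_m),
     (forall i, A (B i)) /\ Z = \sum_i a i *: B i].

Definition derived_algebra (l : set 'rV[R]_m) : set 'rV[R]_m :=
  linear_span [set Z | exists X Y, [/\ l X, l Y & Z = lie_bracket X Y]].

End LieAlgebra.

Arguments derived_algebra {R m} G l.

Section Dual.
Context {R : realType} {m : nat}.

(* Elements of the dual g^* are column vectors. *)
Definition pairing (a : 'cV[R]_m) (X : 'rV[R]_m) : R := (X *m a) 0 0.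

Definition annihilator (l : set 'rV[R]_m) : set 'cV[R]_m :=
  [set a | forall X, l X -> pairing a X = 0].

(* (lin1_mx (Ad g^-1) *m a) is the column vector of a o Ad(g^-1). *)
Definition coAd {G : lieGroupType R m} (g : G) (a : 'cV[R]_m) : 'cV[R]_m :=
  lin1_mx (Ad g^-1%g) *m a.

End Dual.

(* A Lie subgroup is given as a Lie group H with an injective immersion into
   G that is a group homomorphism; the subset of G is the range of i. *)
Definition lie_subgroup (R : realType) (k m : nat) (H : lieGroupType R k)
    (G : lieGroupType R m) (i : H -> G) : Prop :=
  [/\ forall a b, i (a * b)%g = (i a * i b)%g,
      injective i,
      smooth_map i &
      forall h, injective (tangent_map i h)].

Definition subgroup_lie_algebra (R : realType) (k m : nat)
    (H : lieGroupType R k) (G : lieGroupType R m) (i : H -> G) :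
    set 'rV[R]_m :=
  range (tangent_map i 1%g).

Section Actions.
Context {R : realType} {m n : nat} {G : lieGroupType R m}
  {M : manifoldType R n}.

Definition smooth_action (act : G -> M -> M) : Prop :=
  [/\ forall x, act 1%g x = x,
      forall g h x, act (g * h)%g x = act g (act h x) &
      smooth_map2 act].

Definition symplectic_action (w : M -> 'rV[R]_n -> 'rV[R]_n -> R)
    (act : G -> M -> M) : Prop :=
  forall g x u v,
    w (act g x) (tangent_map (act g) x u) (tangent_map (act g) x v) = w x u v.

Definition fundamental_field (expG : 'rV[R]_m -> G) (act : G -> M -> M)
    (X : 'rV[R]_m) (x : M) : 'rV[R]_n :=
  velocity (fun t : R => act (expG (t *: X)) x) 0.

Definition moment_map (w : M -> 'rV[R]_n -> 'rV[R]_n -> R)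
    (expG : 'rV[R]_m -> G) (act : G -> M -> M) (mu : M -> 'cV[R]_m) : Prop :=
  smooth_fun mu /\
  forall X x v, differential (fun y => pairing (mu y) X) x v
                = w x (fundamental_field expG act X x) v.

Definition Ad_equivariant (act : G -> M -> M) (mu : M -> 'cV[R]_m) : Prop :=
  forall g x, mu (act g x) = coAd g (mu x).

Definition orbit_of (act : G -> M -> M) (L : set G) (x : M) : set M :=
  [set act g x | g in L].

Definition orbit_tangent (expG : 'rV[R]_m -> G) (act : G -> M -> M)
    (l : set 'rV[R]_m) (y : M) : set 'rV[R]_n :=
  [set fundamental_field expG act X y | X in l].

Definition isotropic_orbit (w : M -> 'rV[R]_n -> 'rV[R]_n -> R)
    (expG : 'rV[R]_m -> G) (act : G -> M -> M) (L : set G) (l : set 'rV[R]_m)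
    (x : M) : Prop :=
  forall y, orbit_of act L x y ->
  forall u v, orbit_tangent expG act l y u -> orbit_tangent expG act l y v ->
    w y u v = 0.

End Actions.

(* Main.v *)
Require Import Defs.
From mathcomp Require Import all_boot all_order all_algebra.
From mathcomp Require Import all_classical all_reals all_analysis.
From mathcomp Require Import ring.

Set Implicit Arguments.
Unset Strict Implicit.
Unset Printing Implicit Defensive.

Import Order.TTheory GRing.Theory Num.Theory.
Import numFieldNormedType.Exports.
Local Open Scope classical_set_scope.
Local Open Scope ring_scope.

(** The whole statement rests on one identity, valid at every point y of M and
    for all X, Y in the Lie algebra of G:
      w_y(X~, Y~) = <mu(y), [X, Y]>.
    By the defining property of the moment map the left-hand side is the
    derivative of <mu, X> in the direction of Y~(y), that is, the derivative at
    0 of t |-> <mu(exp(tY) y), X>; equivariance turns this function into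
    t |-> <mu(y), Ad(exp(tY)^-1) X>, and the derivative of Ad(exp(tY)^-1) X at
    0 is [X, Y] ([derive_Ad_inv], [symplectic_fundamental_fields_bracket]).
    At y = x the identity says that w vanishes on T_x(Lx) exactly when mu(x)
    kills all brackets of elements of l, hence their span l'.

    It remains to pass from x to the other points g x of the orbit, g in L.
    Since X~(g x) is the image under the translation by g of (Ad(g^-1) X)~(x)
    ([fundamental_field_act]), since g preserves w, and since Ad(g^-1)
    preserves l ([Ad_subgroup]), isotropy at x gives isotropy at g x.

    The derivative of Ad is computed in the chart around the unit of G, where
    multiplication becomes a smooth map m(p, q) near (p0, p0). The right and
    left translates of X are D_(X, 0) m(p0, p) and D_(0, X) m(p, p0), and the
    bracket of left-invariant fields is
      [X, Y] = D_(X, 0) D_(0, Y) m - D_(Y, 0) D_(0, X) m  at (p0, p0).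
    Ad(g^-1) X is obtained by moving X to g by right translation and back by
    left translation, so Ad(g^-1) X - X is the left translate by g^-1 of the
    difference of the right and left translates of X at g. This difference
    vanishes at g = 1, so only its own derivative matters there; the equality
    of mixed second derivatives ([schwarz]) identifies it with the bracket. *)

(** * Directional derivatives and Schwarz's theorem *)

Section Calculus.
Context {R : realType}.

Lemma near_eq_diff (E F : normedModType R) (f g : E -> F) (x : E) :
  {near x, f =1 g} -> differentiable f x ->
  differentiable g x /\ 'd g x = 'd f x :> (E -> F).
Proof.
move=> fg df.
have cdf : continuous ('d f x) by exact: diff_continuous.
have dg : g \o shift x = cst (g x) + 'd f x +o_ 0 id.
  apply/eqaddoP => e e0.
  have /diff_locally/eqaddoP/(_ e e0) fo := df.
  have fg0 : \forall h \near (0 : E), f (h + x) = g (h + x).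
    by have := fg; rewrite (near_shift 0) /= subr0.
  near=> h.
  have : `|(f \o shift x - (cst (f x) + 'd f x)) h| <= e * `|id h| by near: h.
  rewrite -[(f \o shift x - _) h]/(f (h + x) - (f x + 'd f x h)).
  rewrite -[(g \o shift x - _) h]/(g (h + x) - (g x + 'd f x h)).
  have -> : f (h + x) = g (h + x) by near: h.
  by rewrite (nbhs_singleton fg).
have dE := diff_unique cdf dg.
split; last exact: dE.
by apply/diff_locallyP; rewrite dE; split; [exact: cdf|exact: dg].
Unshelve. all: by end_near. Qed.

(** The mean value theorem is applied once, to the increment of f along t v as
    a function of the displacement along u; differentiability of D_u f at the
    single point p then evaluates the resulting increment of D_u f. *)
Lemma second_difference (E : normedModType R) (f : E -> R) (p u v : E) :
  (\near p, differentiable f p) ->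
  differentiable (fun q => 'D_u f q) p ->
  forall e, 0 < e -> \forall t \near 0^'+,
    `|f (p + t *: u + t *: v) - f (p + t *: u) - f (p + t *: v) + f p
      - t ^+ 2 * 'D_v (fun q => 'D_u f q) p| <= e * t ^+ 2.
Proof.
move=> df dg e e0; set g := fun q => 'D_u f q.
(* t * C bounds the displacements s u + b v with s, b <= t; 1 keeps C > 0. *)
pose C := `|u| + `|v| + 1.
have C0 : 0 < C by rewrite ltr_wpDl // addr_ge0.
have e'0 : 0 < e / (2 * C) by rewrite divr_gt0 // mulr_gt0.
have /diff_locally/eqaddoP/(_ _ e'0) go := dg.
have df0 : \forall h \near (0 : E), differentiable f (h + p).
  by have := df; rewrite (near_shift 0) /= subr0.
have : \forall h \near (0 : E), differentiable f (h + p) /\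
   `|g (h + p) - (g p + 'd g p h)| <= e / (2 * C) * `|h|.
  by apply: filterI.
move=> /nbhs_normP[r /= r0 rP].
have {}rP h : `|h| < r -> differentiable f (h + p) /\
   `|g (h + p) - (g p + 'd g p h)| <= e / (2 * C) * `|h|.
  by move=> hr; apply: rP; rewrite /ball_ /= sub0r normrN.
near=> t.
have t0 : 0 < t by [].
have tr : t * C < r.
  rewrite -ltr_pdivlMr //; near: t; apply: nbhs_right_lt.
  by rewrite divr_gt0.
have small s b : 0 <= s <= t -> 0 <= b <= t -> `|s *: u + b *: v| <= t * C.
  move=> /andP[s0 st] /andP[b0 bt].
  rewrite (le_trans (ler_normD _ _)) // !normrZ !ger0_norm // /C.
  rewrite mulrDr mulr1 mulrDr -[leLHS]addr0 lerD ?(ltW t0) //.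
  by rewrite lerD // ler_wpM2r.
(* The second difference is phi t - phi 0. *)
pose phi s := f (s *: u + t *: v + p) - f (s *: u + p).
pose dphi s := g (s *: u + t *: v + p) - g (s *: u + p).
have tt : 0 <= t <= t by rewrite (ltW t0) lexx.
have zt : (0:R) <= 0 <= t by rewrite lexx (ltW t0).
have phid s : 0 <= s <= t -> is_derive s 1 phi (dphi s).
  move=> sI; have line b : 0 <= b <= t ->
      is_derive s 1 (fun s : R => f (s *: u + b *: v + p)) (g (s *: u + b *: v + p)).
    move=> bI.
    have fd : differentiable f (s *: u + b *: v + p).
      by have [] := rP _ (le_lt_trans (small _ _ sI bI) tr).
    have ld : is_diff s (fun s : R => s *: u + b *: v + p) ( *:%R^~ u).
      rewrite (_ : (fun s0 : R => _) = ( *:%R^~ u) + cst (b *: v + p)); last first.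
        by apply/funext => s0; rewrite /cst /= -[RHS]/(_ + _) addrA.
      rewrite -[X in is_diff _ _ X]addr0.
      exact: is_diffD.
    have cd : differentiable (f \o (fun s : R => s *: u + b *: v + p)) s.
      exact: differentiable_comp.
    apply: DeriveDef; first exact: diff_derivable.
    rewrite deriveE // diff_comp //= diff_val scale1r.
    by rewrite /g deriveE.
  rewrite /phi /dphi.
  have := line t tt; have := line 0 zt.
  rewrite (_ : (fun s : R => f (s *: u + 0 *: v + p))
      = fun s => f (s *: u + p)); last first.
    by apply/funext => s0; rewrite scale0r addr0.
  rewrite scale0r addr0 => l0 lt'.
  exact: is_deriveB.
have [||c] := @MVT_segment R phi dphi 0 t (ltW t0).
- by move=> s; rewrite in_itv /= => /andP[/ltW s0 /ltW st]; apply: phid; rewrite s0 st.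
- apply: derivable_within_continuous => s; rewrite in_itv /= => sI.
  by have [] := phid _ sI.
rewrite in_itv /= subr0 => cI phiE.
have -> : f (p + t *: u + t *: v) - f (p + t *: u) - f (p + t *: v) + f p
    = dphi c * t.
  rewrite -phiE /phi scale0r !add0r [t *: u + t *: v + p]addrC addrA.
  by rewrite [t *: u + p]addrC [t *: v + p]addrC; ring.
have [_ c1] := rP _ (le_lt_trans (small _ _ cI tt) tr).
have [_] := rP _ (le_lt_trans (small _ _ cI zt) tr).
have := small _ _ cI zt.
rewrite scale0r !addr0 => cn c2.
rewrite deriveE // expr2 -mulrA -(mulrC t) -mulrBr normrM (gtr0_norm t0) (mulrC e).
rewrite -mulrA; apply: ler_wpM2l; first exact: ltW.
have -> : dphi c - t * 'd g p v =
   (g (c *: u + t *: v + p) - (g p + 'd g p (c *: u + t *: v)))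
   - (g (c *: u + p) - (g p + 'd g p (c *: u))).
  have -> : 'd g p (c *: u + t *: v) = 'd g p (c *: u) + t * 'd g p v.
    by rewrite linearD; congr (_ + _); exact: linearZ.
  by rewrite /dphi; ring.
rewrite (le_trans (ler_normB _ _)) //.
apply: (@le_trans _ _ (e / (2 * C) * (t * C) + e / (2 * C) * (t * C))).
  rewrite lerD //.
    by apply: le_trans c1 _; apply: ler_wpM2l; [exact: ltW|exact: small].
  by apply: le_trans c2 _; apply: ler_wpM2l; first exact: ltW.
rewrite le_eqVlt; apply/orP; left; apply/eqP.
by field; rewrite gt_eqF.
Unshelve. all: by end_near. Qed.

(** The second difference is symmetric in u and v, and equals t^2 times either
    mixed derivative up to o(t^2). *)
Lemma schwarz (E : normedModType R) (f : E -> R) (p u v : E) :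
  (\near p, differentiable f p) ->
  differentiable (fun q => 'D_u f q) p ->
  differentiable (fun q => 'D_v f q) p ->
  'D_v (fun q => 'D_u f q) p = 'D_u (fun q => 'D_v f q) p.
Proof.
move=> df du dv.
apply/eqP; rewrite -subr_eq0 -normr_le0; apply/ler_addgt0Pr => e e0; rewrite add0r.
have e20 : 0 < e / 2 by rewrite divr_gt0.
have H1 := second_difference v df du e20.
have H2 := second_difference u df dv e20.
have [t [t0 [+]]] := filter_ex (filterI (nbhs_right_gt 0) (filterI H2 H1)).
have t20 : 0 < t ^+ 2 by rewrite exprn_gt0.
rewrite (addrAC p (t *: v)).
move: ('D_v _ p) ('D_u _ p) (f (p + t *: u + t *: v)) (f (p + t *: u))
  (f (p + t *: v)) (f p) => x y a b c d A1 A2.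
rewrite -(ler_pM2r t20) -[X in _ * X <= _](gtr0_norm t20) -normrM.
have := lerD A1 A2; rewrite -mulrDl -splitr; apply: le_trans.
apply: le_trans (ler_normB _ _).
by rewrite le_eqVlt; apply/orP; left; apply/eqP; congr (`| _ |); ring.
Qed.

Lemma schwarz_rV (E : normedModType R) n (f : E -> 'rV[R]_n) (p u v : E) :
  (\near p, differentiable f p) ->
  differentiable (fun q => 'D_u f q) p ->
  differentiable (fun q => 'D_v f q) p ->
  'D_v (fun q => 'D_u f q) p = 'D_u (fun q => 'D_v f q) p.
Proof.
move=> df du dv.
have comp (g : E -> 'rV[R]_n) q j : differentiable g q ->
    differentiable (fun q => g q 0 j) q.
  move=> dg; apply: (@differentiable_comp _ _ _ _ g (fun N : 'rV[R]_n => N 0 j)) => //.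
  exact: differentiable_coord.
have coordD a j : {near p, (fun q => 'D_a f q 0 j)
    =1 (fun q => 'D_a (fun q => f q 0 j) q)}.
  apply: filterS df => q dfq.
  by rewrite (derive_mx (diff_derivable (v := a) dfq)) mxE.
apply/rowP => j.
have entry a b : differentiable (fun q => 'D_a f q) p ->
    'D_b (fun q => 'D_a f q) p 0 j = 'D_b (fun q => 'D_a (fun q => f q 0 j) q) p.
  move=> da; rewrite (derive_mx (diff_derivable (v := b) da)) mxE.
  exact: near_eq_derive (coordD a j).
have e1 := entry u v du; have e2 := entry v u dv.
apply: etrans e1 _; apply: etrans (esym e2).
apply: schwarz.
- by apply: filterS df => q; exact: comp.
- exact: (near_eq_diff (coordD u j) (comp _ _ j du)).1.
- exact: (near_eq_diff (coordD v j) (comp _ _ j dv)).1.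
Qed.

Lemma derive_slice_l (E F V : normedModType R) (h : E * F -> V) p q u :
  differentiable h (p, q) ->
  differentiable (fun p => h (p, q)) p /\
  'D_u (fun p => h (p, q)) p = 'D_(u, 0) h (p, q).
Proof.
move=> dh; pose j (a : E) : E * F := (id a, cst q a).
have dj : is_diff p j (fun a => (id a, 0 a)) by exact: is_diff_pair.
have dhj : differentiable (h \o j) p by exact: differentiable_comp.
split; first exact: dhj.
apply: etrans (deriveE _ dhj) _.
rewrite diff_comp; [|exact: ex_diff|exact: dh].
by rewrite /= diff_val deriveE.
Qed.

Lemma derive_slice_r (E F V : normedModType R) (h : E * F -> V) p q u :
  differentiable h (p, q) ->
  differentiable (fun q => h (p, q)) q /\
  'D_u (fun q => h (p, q)) q = 'D_(0, u) h (p, q).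
Proof.
move=> dh; pose j (a : F) : E * F := (cst p a, id a).
have dj : is_diff q j (fun a => (0 a, id a)) by exact: is_diff_pair.
have dhj : differentiable (h \o j) q by exact: differentiable_comp.
split; first exact: dhj.
apply: etrans (deriveE _ dhj) _.
rewrite diff_comp; [|exact: ex_diff|exact: dh].
by rewrite /= diff_val deriveE.
Qed.

(** Where f vanishes, the difference quotient of f g is that of f times g, so
    that continuity of g is enough. Below, g is a left translation along a
    curve, which is only known to be continuous. *)
Lemma is_derive_mul_vanishing (f g : R -> R) (t df : R) :
  f t = 0 -> is_derive t 1 f df -> {for t, continuous g} ->
  is_derive t 1 (fun s => f s * g s) (df * g t).
Proof.
move=> f0 [dvf <-] cg.
have lim_ : (fun h : R => h^-1 *: (f (h *: 1 + t) * g (h *: 1 + t) - f t * g t)) @ 0^'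
    --> 'D_1 f t * g t.
  have -> : (fun h : R => h^-1 *: (f (h *: 1 + t) * g (h *: 1 + t) - f t * g t))
    = (fun h : R => (h^-1 *: (f (h *: 1 + t) - f t)) * g (h *: 1 + t)).
    by apply/funext => h; rewrite f0 mul0r !subr0 scalerAl.
  apply: cvgM; first exact: dvf.
  apply: (cvg_comp (fun h : R => h *: 1 + t) g); last exact: cg.
  have cl : {for 0, continuous (fun h : R => h *: (1 : R) + t)}.
    by apply: cvgD; [exact: scalel_continuous|exact: cvg_cst].
  have cl0 : (fun h : R => h *: (1 : R) + t) @ (0 : R) --> t.
    by have := cl; rewrite /prop_for /continuous_at scale0r add0r.
  by apply: cvg_trans cl0; apply: cvg_app; exact: cvg_within.
by apply: DeriveDef; [apply/cvg_ex; exists ('D_1 f t * g t)|exact: cvg_lim lim_].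
Qed.

End Calculus.

(** * Differentials read in charts *)

Section Charts.
Context {R : realType}.

Lemma near_cdom n (T : topologicalType) (c : chart R n T) x :
  cdom c x -> \near x, cdom c x.
Proof. by move=> cx; apply: open_nbhs_nbhs; split=> //; exact: cdom_open. Qed.

Lemma cimg_chart n (T : topologicalType) (c : chart R n T) x :
  cdom c x -> cimg c (c x).
Proof. by move=> cx; exists x. Qed.

Lemma near_cimg n (T : topologicalType) (c : chart R n T) p :
  cimg c p -> \near p, cimg c p.
Proof. by move=> cp; apply: open_nbhs_nbhs; split=> //; exact: cimg_open. Qed.

Lemma cinvK n (T : topologicalType) (c : chart R n T) p :
  cimg c p -> c (cinv c p) = p.
Proof. by move=> [x cx <-]; rewrite cfunK. Qed.

(** The chain rule through a manifold: both composites with a chart around the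
    intermediate point are maps between normed spaces. It is stated for
    arbitrary normed source and target so as to serve maps, curves and
    vector-valued functions alike. *)
Lemma diff_through_chart (E F : normedModType R) n (T : topologicalType)
    (d : chart R n T) (a : E -> T) (g : T -> F) (e : E) :
  {for e, continuous a} -> cdom d (a e) ->
  differentiable (d \o a) e -> differentiable (g \o cinv d) (d (a e)) ->
  differentiable (g \o a) e /\
  'd (g \o a) e = 'd (g \o cinv d) (d (a e)) \o 'd (d \o a) e :> (E -> F).
Proof.
move=> ca dae da dg.
have loc : {near e, (g \o cinv d) \o (d \o a) =1 g \o a}.
  near=> z; rewrite /= cfunK //.
  by near: z; apply: ca; exact: near_cdom.
have [dga ->] := near_eq_diff loc (differentiable_comp da dg).
by split=> //; rewrite diff_comp.
Unshelve. all: by end_near. Qed.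

(** [tangent_map] is this differential in the preferred charts at x and f x.
    Keeping the charts as parameters allows a fixed chart to be used while the
    point moves, as differentiating along a curve requires. *)
Definition local_diff m n (M N : topologicalType) (c : chart R m M)
    (d : chart R n N) (f : M -> N) (x : M) : 'rV[R]_m -> 'rV[R]_n :=
  'd (d \o f \o cinv c) (c x).

Definition diff_in m n (M N : topologicalType) (c : chart R m M)
    (d : chart R n N) (f : M -> N) (x : M) : Prop :=
  [/\ {for x, continuous f}, cdom c x, cdom d (f x) &
      differentiable (d \o f \o cinv c) (c x)].

Lemma cinv_continuous_at m (M : topologicalType) (c : chart R m M) x :
  cdom c x -> {for c x, continuous (cinv c)}.
Proof. by move=> cx; apply: cinv_continuous; exists x. Qed.

Lemma local_diff_comp k m n (L M N : topologicalType) (b : chart R k L)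
    (c : chart R m M) (d : chart R n N) (f : L -> M) (g : M -> N) x y :
  f x = y -> diff_in b c f x -> diff_in c d g y ->
  diff_in b d (g \o f) x /\
  forall v, local_diff b d (g \o f) x v
    = local_diff c d g y (local_diff b c f x v).
Proof.
move=> <- [cf bx cfx df] [cg _ dgf dg].
have cfb : {for b x, continuous (f \o cinv b)}.
  apply: (@continuous_comp _ _ _ (cinv b) f); first exact: cinv_continuous_at.
  by rewrite cfunK.
have ex : (f \o cinv b) (b x) = f x by rewrite /= cfunK.
have [] := @diff_through_chart _ _ _ _ c (f \o cinv b) (d \o g) (b x) cfb.
- by rewrite ex.
- exact: df.
- by rewrite ex.
rewrite ex => dgf' E; split; last by move=> v; exact: (congr1 (@^~ v) E).
by split; [exact: (@continuous_comp _ _ _ f g)|exact: bx|exact: dgf|exact: dgf'].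
Qed.

Section Manifolds.
Context {m n : nat} {M : manifoldType R m} {N : manifoldType R n}.

Lemma smooth_diff_in (f : M -> N) x y z :
  smooth_map f -> cdom (chart_at x) z -> cdom (chart_at y) (f z) ->
  diff_in (chart_at x) (chart_at y) f z.
Proof.
move=> [cf sf] xz yfz; split; [exact: cf|exact: xz|exact: yfz|].
by have [+ _] := sf x y 1%N; apply; exists z.
Qed.

Lemma smooth_diff_at (f : M -> N) x :
  smooth_map f -> diff_in (chart_at x) (chart_at (f x)) f x.
Proof. by move=> sf; apply: smooth_diff_in => //; exact: chart_at_dom. Qed.

End Manifolds.

Section Manifold.
Context {m : nat} {M : manifoldType R m}.

Lemma smooth_map_id : smooth_map (@id M).
Proof. by split=> [x|x y]; [exact: cvg_id|exact: chart_at_compatible]. Qed.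

Lemma id_diff_in x y z : cdom (chart_at x) z -> cdom (chart_at y) z ->
  diff_in (chart_at x) (chart_at y) (@id M) z.
Proof. exact: smooth_diff_in smooth_map_id. Qed.

Lemma local_diff_id (c : chart R m M) z : cdom c z ->
  local_diff c c id z = id :> (_ -> _).
Proof.
move=> cz; have loc : {near c z, id =1 c \o id \o cinv c}.
  near=> p; rewrite /= cinvK //; near: p.
  exact/near_cimg/cimg_chart.
have [|_ E] := near_eq_diff loc; first exact: ex_diff.
by rewrite /local_diff E diff_val.
Unshelve. all: by end_near. Qed.

End Manifold.

(** A smooth map of two variables restricts to smooth maps of each variable, and
    the differentials of these are the partial derivatives in product charts. *)
Section Partial.
Context {k m n : nat} {A : manifoldType R k} {B : manifoldType R m}
  {N : manifoldType R n} (f : A -> B -> N).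
Hypothesis sf : smooth_map2 f.

Definition chart2 a b y (pq : 'rV[R]_k * 'rV[R]_m) : 'rV[R]_n :=
  chart_at y (f (cinv (chart_at a) pq.1) (cinv (chart_at b) pq.2)).

Definition chart2_dom a b y : set ('rV[R]_k * 'rV[R]_m) :=
  [set pq | [/\ cimg (chart_at a) pq.1, cimg (chart_at b) pq.2 &
           cdom (chart_at y)
             (f (cinv (chart_at a) pq.1) (cinv (chart_at b) pq.2))]].

Lemma chart2_differentiable a b y pq :
  chart2_dom a b y pq -> differentiable (chart2 a b y) pq.
Proof. by have [_ /(_ a b y 1%N) [+ _]] := sf; apply. Qed.

Lemma chart2_derive_differentiable a b y v pq :
  chart2_dom a b y pq -> differentiable (fun z => 'D_v (chart2 a b y) z) pq.
Proof. by have [_ /(_ a b y 2%N) [_ /(_ v) [+ _]]] := sf; apply. Qed.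

Lemma chart2_dom_at a b y a' b' : cdom (chart_at a) a' -> cdom (chart_at b) b' ->
  cdom (chart_at y) (f a' b') ->
  chart2_dom a b y (chart_at a a', chart_at b b').
Proof. by move=> aa bb yy; split=> /=; [exists a'|exists b'|rewrite !cfunK]. Qed.

Lemma chart2_nbhs a b y a' b' : cdom (chart_at a) a' -> cdom (chart_at b) b' ->
  cdom (chart_at y) (f a' b') ->
  nbhs (chart_at a a', chart_at b b') (chart2_dom a b y).
Proof.
move=> aa bb yy.
have [cf _] := sf.
have c1 : (fun pq : 'rV[R]_k * 'rV[R]_m => pq.1) @ (chart_at a a', chart_at b b')
   --> chart_at a a' by exact: cvg_fst.
have c2 : (fun pq : 'rV[R]_k * 'rV[R]_m => pq.2) @ (chart_at a a', chart_at b b')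
   --> chart_at b b' by exact: cvg_snd.
have h1 := cinv_continuous_at aa; have h2 := cinv_continuous_at bb.
have e1 := cfunK aa; have e2 := cfunK bb.
rewrite /prop_for /continuous_at in h1 h2; rewrite e1 in h1; rewrite e2 in h2.
have h := cvg_pair (cvg_comp _ _ c1 h1) (cvg_comp _ _ c2 h2).
have hf := cvg_comp _ _ (h _ _ _) (cf (a', b')).
near=> pq; split.
- by near: pq; apply: c1; exact/near_cimg/cimg_chart.
- by near: pq; apply: c2; exact/near_cimg/cimg_chart.
- by near: pq; apply: hf; exact: near_cdom.
Unshelve. all: by end_near. Qed.

Lemma diff_in_partial_r a b y a' b' : cdom (chart_at a) a' ->
  cdom (chart_at b) b' -> cdom (chart_at y) (f a' b') ->
  diff_in (chart_at b) (chart_at y) (f a') b' /\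
  forall v, local_diff (chart_at b) (chart_at y) (f a') b' v
    = 'D_(0, v) (chart2 a b y) (chart_at a a', chart_at b b').
Proof.
move=> aa bb yy.
have dc := chart2_differentiable (chart2_dom_at aa bb yy).
pose j (q : 'rV[R]_m) : 'rV[R]_k * 'rV[R]_m := (cst (chart_at a a') q, id q).
have dj : is_diff (chart_at b b') j (fun q => (0 q, id q)) by exact: is_diff_pair.
have E : chart2 a b y \o j = chart_at y \o f a' \o cinv (chart_at b).
  by apply/funext => q; rewrite /chart2 /= cfunK.
split.
  split; [|by []|by []|by rewrite -E; apply: differentiable_comp].
  have [cf _] := sf.
  apply: (@continuous_comp _ _ _ (fun b => (a', b))
    (fun ab => f ab.1 ab.2)); last exact: cf.
  by apply: cvg_pair; [exact: cvg_cst|exact: cvg_id].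
by move=> v; rewrite /local_diff -E diff_comp //= diff_val deriveE.
Qed.

Lemma diff_in_partial_l a b y a' b' : cdom (chart_at a) a' ->
  cdom (chart_at b) b' -> cdom (chart_at y) (f a' b') ->
  diff_in (chart_at a) (chart_at y) (f^~ b') a' /\
  forall v, local_diff (chart_at a) (chart_at y) (f^~ b') a' v
    = 'D_(v, 0) (chart2 a b y) (chart_at a a', chart_at b b').
Proof.
move=> aa bb yy.
have dc := chart2_differentiable (chart2_dom_at aa bb yy).
pose j (q : 'rV[R]_k) : 'rV[R]_k * 'rV[R]_m := (id q, cst (chart_at b b') q).
have dj : is_diff (chart_at a a') j (fun q => (id q, 0 q)) by exact: is_diff_pair.
have E : chart2 a b y \o j = chart_at y \o f^~ b' \o cinv (chart_at a).
  by apply/funext => q; rewrite /chart2 /= cfunK.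
split.
  split; [|by []|by []|by rewrite -E; apply: differentiable_comp].
  have [cf _] := sf.
  apply: (@continuous_comp _ _ _ (fun a => (a, b'))
    (fun ab => f ab.1 ab.2)); last exact: cf.
  by apply: cvg_pair; [exact: cvg_id|exact: cvg_cst].
by move=> v; rewrite /local_diff -E diff_comp //= diff_val deriveE.
Qed.

End Partial.
End Charts.

(** * Tangent maps and velocities *)

Section Tangent.
Context {R : realType}.

Definition diff_at m n (M : manifoldType R m) (N : manifoldType R n)
    (f : M -> N) (x : M) : Prop :=
  diff_in (chart_at x) (chart_at (f x)) f x.

(** The intermediate point is a free variable y because the preferred chart is
    attached to the point as an expression: f x often only equals the point at
    which g is known to be differentiable. *)
Lemma tangent_map_comp k m n (L : manifoldType R k) (M : manifoldType R m)
    (N : manifoldType R n) (f : L -> M) (g : M -> N) (x : L) (y : M) :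
  f x = y -> diff_at f x -> diff_at g y ->
  diff_at (g \o f) x /\
  forall v, tangent_map (g \o f) x v = tangent_map g y (tangent_map f x v).
Proof.
by move=> <- df dg; exact: (local_diff_comp (erefl (f x)) df dg).
Qed.

Lemma tangent_mapE m n (M : manifoldType R m) (N : manifoldType R n)
    (f : M -> N) (x : M) (y : N) v :
  f x = y -> tangent_map f x v = local_diff (chart_at x) (chart_at y) f x v.
Proof. by move=> <-. Qed.

Lemma to_chart_tangent_map m n (M : manifoldType R m) (N : manifoldType R n)
    (f : M -> N) (x : M) (y z : N) v :
  f x = y -> diff_at f x -> cdom (chart_at z) y ->
  to_chart (chart_at z) y (tangent_map f x v)
  = local_diff (chart_at x) (chart_at z) f x v.
Proof.
move=> <- df zy.
have dz := id_diff_in (chart_at_dom (f x)) zy.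
exact: (esym ((local_diff_comp (erefl (f x)) df dz).2 v)).
Qed.

Lemma smooth_curve_diff n (M : manifoldType R n) (c : R -> M) t :
  smooth_curve c ->
  {for t, continuous c} /\ differentiable (chart_at (c t) \o c) t.
Proof.
move=> [cc sc]; split; first exact: cc.
have [+ _] := sc (c t) 1%N; apply; exact: chart_at_dom.
Qed.

Lemma velocity_comp m n (M : manifoldType R m) (N : manifoldType R n)
    (c : R -> M) (f : M -> N) (t : R) :
  {for t, continuous c} -> differentiable (chart_at (c t) \o c) t ->
  diff_at f (c t) ->
  [/\ {for t, continuous (f \o c)},
      differentiable (chart_at (f (c t)) \o (f \o c)) t &
      velocity (f \o c) t = tangent_map f (c t) (velocity c t)].
Proof.
move=> cc dc [cf ct fct df].
have [dfc E] := diff_through_chart cc ct dc df.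
split; [exact: (@continuous_comp _ _ _ c f)|exact: dfc|].
rewrite /velocity derive1E'; last exact: dfc.
rewrite derive1E'; last exact: dc.
exact: (congr1 (@^~ 1) E).
Qed.

Lemma derive_along_curve n (M : manifoldType R n) (V : normedModType R)
    (f : M -> V) (c : R -> M) (t : R) :
  {for t, continuous c} -> differentiable (chart_at (c t) \o c) t ->
  differentiable (f \o cinv (chart_at (c t))) (chart_at (c t) (c t)) ->
  differential f (c t) (velocity c t) = 'D_1 (f \o c) t.
Proof.
move=> cc dc df.
have [dfc E] := diff_through_chart cc (chart_at_dom (c t)) dc df.
rewrite deriveE; last exact: dfc.
rewrite /velocity derive1E'; last exact: dc.
exact/esym/(congr1 (@^~ 1) E).
Qed.

Lemma smooth_map2_diff_l k m n (A : manifoldType R k) (B : manifoldType R m)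
    (N : manifoldType R n) (f : A -> B -> N) a b :
  smooth_map2 f -> diff_at (f^~ b) a.
Proof.
by move=> sf; have [] := diff_in_partial_l sf (chart_at_dom a) (chart_at_dom b)
  (chart_at_dom (f a b)).
Qed.

Lemma smooth_map2_diff_r k m n (A : manifoldType R k) (B : manifoldType R m)
    (N : manifoldType R n) (f : A -> B -> N) a b :
  smooth_map2 f -> diff_at (f a) b.
Proof.
by move=> sf; have [] := diff_in_partial_r sf (chart_at_dom a) (chart_at_dom b)
  (chart_at_dom (f a b)).
Qed.

End Tangent.

(** * The pairing of the Lie algebra with its dual *)

Section Pairing.
Context {R : realType} {m : nat}.
Implicit Types a : 'cV[R]_m.

Lemma pairingD a X Y : pairing a (X + Y) = pairing a X + pairing a Y.
Proof. by rewrite /pairing mulmxDl mxE. Qed.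

Lemma pairingZ a c X : pairing a (c *: X) = c * pairing a X.
Proof. by rewrite /pairing -scalemxAl mxE. Qed.

Lemma pairing_sum a k (F : 'I_k -> 'rV[R]_m) :
  pairing a (\sum_j F j) = \sum_j pairing a (F j).
Proof. by rewrite /pairing mulmx_suml summxE. Qed.

Lemma pairing_continuous a : continuous (pairing a).
Proof.
move=> X; apply: differentiable_continuous.
rewrite (_ : pairing a = \sum_j (a j 0 *: (fun b : 'rV[R]_m => b 0 j : R))).
  apply: differentiable_sum => j; apply: differentiableZ.
  exact: differentiable_coord.
apply/funext => b; rewrite /pairing mxE fct_sumE; apply: eq_bigr => j _.
by rewrite mulrC.
Qed.

Lemma pairing_differentiable (X : 'rV[R]_m) (a : 'cV[R]_m) :
  differentiable (pairing^~ X) a.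
Proof.
rewrite (_ : pairing^~ X = \sum_j (X 0 j *: (fun b : 'cV[R]_m => b j 0 : R))).
  apply: differentiable_sum => j; apply: differentiableZ.
  exact: differentiable_coord.
by apply/funext => b; rewrite /pairing mxE fct_sumE.
Qed.

Lemma annihilator_linear_span (A : set 'rV[R]_m) a :
  annihilator (linear_span A) a <-> annihilator A a.
Proof.
split=> [aA X AX|aA _ [k [b [B [AB ->]]]]].
  apply: aA; exists 1%N, (fun=> 1), (fun=> X); split=> //.
  by rewrite big_ord1 scale1r.
by rewrite pairing_sum big1 // => j _; rewrite pairingZ aA ?mulr0.
Qed.

End Pairing.

(** * Conjugation and the adjoint representation *)

Section Groups.
Context {R : realType} {m : nat} {G : lieGroupType R m}.
Implicit Types g h : G.

Lemma mull_diff g h : diff_at (fun a : G => (g * a)%g) h.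
Proof. exact: smooth_map2_diff_r smooth_mulg. Qed.

Lemma mulr_diff g h : diff_at (fun a : G => (a * g)%g) h.
Proof. exact: (smooth_map2_diff_l _ _ smooth_mulg). Qed.

Definition conj_map g (a : G) : G := (g * a * g^-1)%g.

Lemma conj_map1 g : conj_map g 1%g = 1%g.
Proof. by rewrite /conj_map mulg1 mulgV. Qed.

Lemma conj_diff g h : diff_at (conj_map g) h.
Proof.
by have [] := tangent_map_comp (erefl (g * h)%g) (mull_diff g h)
  (mulr_diff g^-1%g (g * h)%g).
Qed.

Lemma pairing_coAd g (a : 'cV[R]_m) X :
  pairing (coAd g a) X = pairing a (Ad g^-1%g X).
Proof. by rewrite /pairing /coAd mulmxA mul_rV_lin1. Qed.

End Groups.

Section Subgroups.
Context {R : realType} {k m : nat} {H : lieGroupType R k} {G : lieGroupType R m}.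
Variable i : H -> G.
Hypothesis Hi : lie_subgroup i.

Lemma subgroup_hom1 : i 1%g = 1%g.
Proof.
have [iM _ _ _] := Hi; have := iM 1%g 1%g; rewrite mulg1 => E.
by apply: (@mulgI _ (i 1%g)); rewrite -E mulg1.
Qed.

Lemma subgroup_homV h : i h^-1%g = (i h)^-1%g.
Proof.
have [iM _ _ _] := Hi.
by apply: (@mulgI _ (i h)); rewrite -iM !mulgV subgroup_hom1.
Qed.

(** The inclusion intertwines conjugation by h in L and by i h in G;
    differentiate i (h a h^-1) = (i h) (i a) (i h)^-1 at the unit. *)
Lemma Ad_subgroup h X : subgroup_lie_algebra i X ->
  subgroup_lie_algebra i (Ad (i h) X).
Proof.
have [iM _ si _] := Hi.
move=> [Z _ <-]; exists (Ad h Z) => //.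
have [_ E1] := tangent_map_comp (conj_map1 h) (conj_diff h 1%g)
  (smooth_diff_at 1%g si).
have [_ E2] := tangent_map_comp subgroup_hom1 (smooth_diff_at 1%g si)
  (conj_diff (i h) 1%g).
have ic : i \o conj_map h = conj_map (i h) \o i.
  by apply/funext => a; rewrite /= /conj_map !iM subgroup_homV.
exact: etrans (esym (E1 Z)) (etrans (congr1 (fun f => tangent_map f 1%g Z) ic) (E2 Z)).
Qed.

End Subgroups.

(** * Fundamental vector fields *)

Section Actions.
Context {R : realType} {m n : nat} {G : lieGroupType R m}
  {M : manifoldType R n}.
Variables (expG : 'rV[R]_m -> G) (act : G -> M -> M).
Hypothesis Hexp : exponential_map expG.
Hypothesis Hact : smooth_action act.

Lemma exp_curve X :
  [/\ {for 0, continuous (fun t : R => expG (t *: X))},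
      differentiable (chart_at (expG ((0 : R) *: X)) \o (fun t : R => expG (t *: X))) 0,
      expG ((0 : R) *: X) = 1%g & velocity (fun t : R => expG (t *: X)) 0 = X].
Proof.
have [[sc cM] vX] := Hexp X.
have [c1 c2] := smooth_curve_diff 0 sc.
split; [exact: c1|exact: c2| |exact: vX].
apply: (@mulgI _ (expG ((0 : R) *: X))).
by rewrite -cM addr0 mulg1.
Qed.

Lemma orbit_map_diff x g : diff_at (act^~ x) g.
Proof. by have [_ _ sa] := Hact; exact: smooth_map2_diff_l. Qed.

Lemma translation_diff g x : diff_at (act g) x.
Proof. by have [_ _ sa] := Hact; exact: smooth_map2_diff_r. Qed.

Lemma orbit_curve X x (c := fun t : R => act (expG (t *: X)) x) :
  [/\ {for 0, continuous c},
      differentiable (chart_at (c 0) \o c) 0, c 0 = x &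
      velocity c 0 = tangent_map (act^~ x) 1%g X].
Proof.
have [c1 c2 c3 c4] := exp_curve X; have [a1 _ _] := Hact.
have [v1 v2 v3] := velocity_comp c1 c2 (orbit_map_diff x _).
split; [exact: v1|exact: v2|by rewrite /c c3 a1|].
by move: v3; rewrite c4 c3.
Qed.

Lemma fundamental_fieldE X x :
  fundamental_field expG act X x = tangent_map (act^~ x) 1%g X.
Proof. by have [] := orbit_curve X x. Qed.

(** Differentiate a (g x) = g ((g^-1 a g) x) in a at the unit of G. *)
Lemma fundamental_field_act g X x :
  fundamental_field expG act X (act g x)
  = tangent_map (act g) x (fundamental_field expG act (Ad g^-1%g X) x).
Proof.
have [a1 aM _] := Hact; rewrite !fundamental_fieldE.
have [d1 E1] := tangent_map_comp (conj_map1 g^-1%g) (conj_diff g^-1%g 1%g)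
  (orbit_map_diff x 1%g).
have ex : (act^~ x \o conj_map g^-1%g) 1%g = x.
  by rewrite /= conj_map1 a1.
have [d2 E2] := tangent_map_comp ex d1 (translation_diff g x).
have ea : act^~ (act g x) = act g \o (act^~ x \o conj_map g^-1%g).
  by apply/funext => a; rewrite /= /conj_map -!aM invgK !mulgA mulgV mul1g.
apply: etrans (congr1 (fun f => tangent_map f 1%g X) ea) _.
exact: etrans (E2 X) (congr1 (tangent_map (act g) x) (E1 X)).
Qed.

(** By definition of the moment map, w(X~, -) is the differential of <mu, X>,
    and Y~ is the velocity of the curve exp(tY) x. *)
Lemma symplectic_fundamental_fields (w : M -> 'rV[R]_n -> 'rV[R]_n -> R)
    (mu : M -> 'cV[R]_m) X Y x :
  moment_map w expG act mu ->
  w x (fundamental_field expG act X x) (fundamental_field expG act Y x)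
  = 'D_1 (fun t : R => pairing (mu (act (expG (t *: Y)) x)) X) 0.
Proof.
move=> [smu dmu]; rewrite -dmu.
have [c1 c2 c3 c4] := orbit_curve Y x.
have df y : differentiable ((fun y => pairing (mu y) X) \o cinv (chart_at y))
    (chart_at y y).
  apply: (@differentiable_comp _ _ _ _ (mu \o cinv (chart_at y)) (pairing^~ X)).
    have [+ _] := smu y 1%N; apply; exact/cimg_chart/chart_at_dom.
  exact: pairing_differentiable.
have := derive_along_curve c1 c2 (df _).
by rewrite c3.
Qed.

End Actions.

(** * The bracket as the derivative of the adjoint representation *)

Section Bracket.
Context {R : realType} {m : nat} {G : lieGroupType R m}.

Local Notation e := (1%g : G).
Local Notation C := (chart_at (1%g : G)).
Local Notation p0 := (chart_at (1%g : G) (1%g : G)).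

Definition mulc : 'rV[R]_m * 'rV[R]_m -> 'rV[R]_m :=
  chart2 (fun g h : G => (g * h)%g) e e e.

Lemma mulc_nbhs :
  nbhs (p0, p0) (chart2_dom (fun g h : G => (g * h)%g) e e e).
Proof.
apply: (chart2_nbhs smooth_mulg); rewrite ?mulg1; exact: chart_at_dom.
Qed.

Lemma mulc_derive_differentiable v :
  differentiable (fun z => 'D_v mulc z) (p0, p0).
Proof.
apply: (chart2_derive_differentiable smooth_mulg).
apply: chart2_dom_at; rewrite ?mulg1; exact: chart_at_dom.
Qed.

Lemma mulc_schwarz u v :
  'D_v (fun z => 'D_u mulc z) (p0, p0) = 'D_u (fun z => 'D_v mulc z) (p0, p0).
Proof.
apply: schwarz_rV; [|exact: mulc_derive_differentiable..].
by apply: filterS mulc_nbhs => z; exact: (chart2_differentiable smooth_mulg).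
Qed.

Lemma mull_in g h : cdom C g -> cdom C h -> cdom C (g * h)%g ->
  diff_in C C (fun a => (g * a)%g) h /\
  forall v, local_diff C C (fun a => (g * a)%g) h v = 'D_(0, v) mulc (C g, C h).
Proof. exact: (diff_in_partial_r smooth_mulg). Qed.

Lemma mulr_in g h : cdom C g -> cdom C h -> cdom C (g * h)%g ->
  diff_in C C (fun a => (a * h)%g) g /\
  forall v, local_diff C C (fun a => (a * h)%g) g v = 'D_(v, 0) mulc (C g, C h).
Proof. exact: (diff_in_partial_l smooth_mulg). Qed.

(** The left-invariant field is given in a chart that varies with the point, and
    read in the chart at the unit; the change of charts is absorbed by the
    chain rule. *)
Lemma chart_left_invariant_field X p : cimg C p ->
  chart_field (left_invariant_field X) C p = 'D_(0, X) mulc (p, p0).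
Proof.
move=> [g Cg <-]; rewrite /chart_field cfunK //.
have C1 : cdom C e by exact: chart_at_dom.
have C1g : cdom C (g * e)%g by rewrite mulg1.
have [_ E] := mull_in Cg C1 C1g.
exact: etrans (to_chart_tangent_map X (mulg1 g) (mull_diff g e) Cg) (E X).
Qed.

Lemma left_invariant_field1 X : left_invariant_field X e = X.
Proof.
rewrite /left_invariant_field.
have -> : (fun h : G => (1 * h)%g) = id by apply/funext => h; rewrite mul1g.
exact: (congr1 (@^~ X) (local_diff_id (chart_at_dom e))).
Qed.

Lemma lie_bracketE X Y : lie_bracket (G := G) X Y
  = 'D_(X, 0) (fun z => 'D_(0, Y) mulc z) (p0, p0)
  - 'D_(Y, 0) (fun z => 'D_(0, X) mulc z) (p0, p0).
Proof.
rewrite /lie_bracket /field_bracket !left_invariant_field1.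
have loc Z : {near p0, chart_field (left_invariant_field Z) C
    =1 (fun p => 'D_(0, Z) mulc (p, p0))}.
  apply: filterS (near_cimg (cimg_chart (chart_at_dom e))) => p.
  exact: chart_left_invariant_field.
have E U V : 'D_U (chart_field (left_invariant_field V) C) p0
    = 'D_(U, 0) (fun z => 'D_(0, V) mulc z) (p0, p0).
  apply: etrans (near_eq_derive U (loc V)) _.
  exact: (derive_slice_l U (mulc_derive_differentiable (0, V))).2.
exact: (congr2 (fun a b => a - b) (E X Y) (E Y X)).
Qed.

Lemma mulc_derive_r v : 'D_(0, v) mulc (p0, p0) = v.
Proof.
have C1 : cdom C e by exact: chart_at_dom.
have C11 : cdom C (e * e)%g by rewrite mulg1.
rewrite -(mull_in C1 C1 C11).2 (_ : (fun h : G => (1 * h)%g) = id).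
  exact: (congr1 (@^~ v) (local_diff_id C1)).
by apply/funext => h; rewrite mul1g.
Qed.

Lemma mulc_derive_l v : 'D_(v, 0) mulc (p0, p0) = v.
Proof.
have C1 : cdom C e by exact: chart_at_dom.
have C11 : cdom C (e * e)%g by rewrite mulg1.
rewrite -(mulr_in C1 C1 C11).2 (_ : (fun h : G => (h * 1)%g) = id).
  exact: (congr1 (@^~ v) (local_diff_id C1)).
by apply/funext => h; rewrite mulg1.
Qed.

(** The difference at g, of coordinates q, between the right and the left
    translates of X from the unit to g. *)
Definition translation_gap (X q : 'rV[R]_m) : 'rV[R]_m :=
  'D_(X, 0) mulc (p0, q) - 'D_(0, X) mulc (q, p0).

(** Differentiating the gap along Y gives D_(0, Y) D_(X, 0) m for its first term
    and D_(Y, 0) D_(0, X) m for its second; exchanging the derivatives in the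
    first one yields the formula for the bracket. *)
Lemma translation_gap_diff X : differentiable (translation_gap X) p0 /\
  forall Y, 'D_Y (translation_gap X) p0 = lie_bracket (G := G) X Y.
Proof.
have d1 Y := derive_slice_r Y (mulc_derive_differentiable (X, 0)).
have d2 Y := derive_slice_l Y (mulc_derive_differentiable (0, X)).
have [d10 _] := d1 0; have [d20 _] := d2 0.
split; first exact: differentiableB.
move=> Y; rewrite lie_bracketE.
apply: etrans (deriveB (diff_derivable d10) (diff_derivable d20)) _.
have [_ E1] := d1 Y; have [_ E2] := d2 Y.
exact: (congr2 (fun a b => a - b) (etrans E1 (mulc_schwarz _ _)) E2).
Qed.

(** Ad(g^-1) moves X to g on the right and back to the unit by left translation
    by g^-1, while moving X to g on the left and back the same way gives X. The
    outer left translation is expanded on the standard basis, which turns a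
    product of linear maps depending on g into products of functions of g. *)
Lemma Ad_inv_gap g X : cdom C g -> cdom C g^-1%g ->
  Ad g^-1%g X = X + \sum_j (translation_gap X (C g) 0 j *:
     'D_(0, delta_mx 0 j) mulc (C g^-1%g, C g)).
Proof.
move=> Cg Cg'.
have C1 : cdom C e by exact: chart_at_dom.
have gg : (g^-1 * g = 1)%g by rewrite mulVg.
have Cgg : cdom C (g^-1 * g)%g by rewrite gg.
have C1g : cdom C (1 * g)%g by rewrite mul1g.
have Cg1 : cdom C (g * 1)%g by rewrite mulg1.
have [dl El] := mull_in Cg' Cg Cgg.
have [dr Er] := mulr_in C1 Cg C1g.
have [dl1 El1] := mull_in Cg C1 Cg1.
have AdE : Ad g^-1%g X =
    local_diff C C (fun a => (g^-1 * a)%g) g ('D_(X, 0) mulc (p0, C g)).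
  rewrite -Er; apply: etrans (tangent_mapE X (conj_map1 g^-1%g)) _.
  apply: etrans _ ((local_diff_comp (f := fun a => (a * g)%g) (x := e)
    (mul1g g) dr dl).2 X).
  apply: (congr1 (fun f => local_diff C C f e X)).
  by apply/funext => h; rewrite /conj_map /= invgK mulgA.
have XE : X = local_diff C C (fun a => (g^-1 * a)%g) g ('D_(0, X) mulc (C g, p0)).
  rewrite -El1; apply: etrans _ ((local_diff_comp (f := fun a => (g * a)%g) (x := e)
    (mulg1 g) dl1 dl).2 X).
  apply: etrans (esym (congr1 (@^~ X) (local_diff_id C1))) _.
  apply: (congr1 (fun f => local_diff C C f e X)).
  by apply/funext => h; rewrite /= mulKg.
rewrite {2}XE AdE; apply/eqP; rewrite addrC -subr_eq; apply/eqP.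
rewrite /local_diff -linearB -/(translation_gap X (C g)).
rewrite [in LHS](row_sum_delta (translation_gap X (C g))) linear_sum.
apply: eq_bigr => j _; rewrite linearZ /=; congr (_ *: _).
exact: El.
Qed.

(** In the expansion of [Ad_inv_gap] every coefficient vanishes at the unit, and
    the vectors are continuous in g with value the j-th basis vector there; the
    product rule thus leaves the derivative of the gap alone. *)
Lemma derive_Ad_inv (a : 'cV[R]_m) (X Y : 'rV[R]_m) (c : R -> G) :
  {for 0, continuous c} -> differentiable (chart_at (c 0) \o c) 0 ->
  c 0 = 1%g -> velocity c 0 = Y ->
  'D_1 (fun t : R => pairing a (Ad (c t)^-1%g X)) 0
  = pairing a (lie_bracket (G := G) X Y).
Proof.
move=> cc + c0; rewrite /velocity c0 => dc vY.
have C1 : cdom C e by exact: chart_at_dom.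
have cinv_c : {for 0, continuous (fun t => (c t)^-1%g)}.
  have [ci _] := @smooth_invg R m G.
  by apply: (@continuous_comp _ _ _ c (fun g : G => g^-1%g)); [exact: cc|exact: ci].
pose N j (t : R) := 'D_(0, delta_mx 0 j) mulc (C (c t)^-1%g, C (c t)).
pose W (j : 'I_m) (t : R) : R := translation_gap X (C (c t)) 0 j.
have nC : \forall t \near (0 : R), cdom C (c t).
  by apply: cc; rewrite c0; exact: near_cdom.
have nC' : \forall t \near (0 : R), cdom C (c t)^-1%g.
  by apply: cinv_c; rewrite c0 invg1; exact: near_cdom.
have loc : \forall t \near (0 : R),
    pairing a X + \sum_j W j t * pairing a (N j t)
    = pairing a (Ad (c t)^-1%g X).
  apply: filterS (filterI nC nC') => t [h1 h2].
  rewrite (Ad_inv_gap _ h1 h2) pairingD pairing_sum; congr (_ + _).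
  by apply: eq_bigr => j _; rewrite pairingZ.
have [dW EW] := translation_gap_diff X.
have Cc0 : (C \o c) 0 = p0 by rewrite /= c0.
have N0 j : N j 0 = delta_mx 0 j by rewrite /N c0 invg1 mulc_derive_r.
have gap0 : translation_gap X p0 = 0.
  by rewrite /translation_gap mulc_derive_l mulc_derive_r subrr.
have cN j : {for 0, continuous (fun t => pairing a (N j t))}.
  apply: (@continuous_comp _ _ _ (N j) (pairing a)); last exact: pairing_continuous.
  have c1 : {for 0, continuous (C \o c)}.
    apply: (@continuous_comp _ _ _ c C); first exact: cc.
    by rewrite c0; exact: cfun_continuous.
  have c2 : {for 0, continuous (C \o (fun t => (c t)^-1%g))}.
    apply: (@continuous_comp _ _ _ (fun t => (c t)^-1%g) C); first exact: cinv_c.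
    by rewrite c0 invg1; exact: cfun_continuous.
  apply: (@continuous_comp _ _ _ (fun t : R => (C (c t)^-1%g, C (c t)))
    (fun z => 'D_(0, delta_mx 0 j) mulc z)).
    exact: cvg_pair c2 c1.
  apply: differentiable_continuous; rewrite c0 invg1.
  exact: mulc_derive_differentiable.
have dWc : differentiable (translation_gap X \o (C \o c)) 0.
  by apply: differentiable_comp; [exact: dc|rewrite Cc0; exact: dW].
have vWc : 'D_1 (translation_gap X \o (C \o c)) 0 = lie_bracket (G := G) X Y.
  apply: etrans (deriveE _ dWc) _.
  rewrite diff_comp; [|exact: dc|by rewrite Cc0; exact: dW].
  by rewrite /= -(derive1E' dc) vY c0 -EW deriveE.
have Wd j : is_derive (0 : R) 1 (W j) (lie_bracket (G := G) X Y 0 j).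
  have dv : derivable (translation_gap X \o (C \o c)) (0 : R) 1 by exact: diff_derivable.
  apply: DeriveDef; first exact: ((derivable_mxP _ _ _).1 dv 0 j).
  by rewrite -vWc (derive_mx dv) mxE.
pose F (t : R) := pairing a X + \sum_j W j t * pairing a (N j t).
have locF : {near 0, F =1 (fun t : R => pairing a (Ad (c t)^-1%g X))} by exact: loc.
have FE := near_eq_derive (1 : R) locF.
apply: etrans (esym FE) _.
have Dt j : is_derive (0 : R) 1 (fun t => W j t * pairing a (N j t))
    (lie_bracket (G := G) X Y 0 j * pairing a (N j 0)).
  by apply: is_derive_mul_vanishing => //; rewrite /W c0 gap0 mxE.
have Ds : is_derive (0 : R) 1 F
   (0 + \sum_j (lie_bracket (G := G) X Y 0 j * pairing a (N j 0))).
  rewrite (_ : F = cst (pairing a X)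
      + \sum_j (fun t => W j t * pairing a (N j t))); last first.
    by apply/funext => t; rewrite -[RHS]/(_ + _) fct_sumE.
  apply: is_deriveD; exact: is_derive_sum.
rewrite derive_val add0r [in RHS](row_sum_delta (lie_bracket X Y)) pairing_sum.
by apply: eq_bigr => j _; rewrite pairingZ N0.
Qed.

End Bracket.

(** * Moment maps and isotropic orbits *)

Section MomentMap.
Context {R : realType} {n m : nat} {M : manifoldType R n} {G : lieGroupType R m}.
Variables (w : M -> 'rV[R]_n -> 'rV[R]_n -> R) (expG : 'rV[R]_m -> G)
    (act : G -> M -> M) (mu : M -> 'cV[R]_m).

(** Equivariance replaces mu along the curve exp(tY) x by the coadjoint action
    of exp(tY), whose effect on X is Ad(exp(tY)^-1). *)
Lemma symplectic_fundamental_fields_bracket X Y x :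
  exponential_map expG -> smooth_action act -> moment_map w expG act mu ->
  Ad_equivariant act mu ->
  w x (fundamental_field expG act X x) (fundamental_field expG act Y x)
  = pairing (mu x) (lie_bracket (G := G) X Y).
Proof.
move=> He Ha Hm Hmu.
have [c1 c2 c3 c4] := exp_curve He Y.
apply: etrans (symplectic_fundamental_fields He Ha X Y x Hm) _.
apply: etrans (derive_Ad_inv (mu x) X c1 c2 c3 c4).
apply: (congr1 (fun f : R -> R => 'D_1 f (0 : R))).
by apply/funext => t; rewrite Hmu pairing_coAd.
Qed.

End MomentMap.

Theorem proposition2p2 (R : realType) (n m k : nat)
    (M : manifoldType R n) (w : M -> 'rV[R]_n -> 'rV[R]_n -> R)
    (G : lieGroupType R m) (expG : 'rV[R]_m -> G)
    (act : G -> M -> M) (mu : M -> 'cV[R]_m)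
    (L : lieGroupType R k) (i : L -> G) (x : M) :
  connected [set: M] ->
  symplectic_form w ->
  exponential_map expG ->
  smooth_action act ->
  symplectic_action w act ->
  moment_map w expG act mu ->
  Ad_equivariant act mu ->
  lie_subgroup i ->
  isotropic_orbit w expG act (range i) (subgroup_lie_algebra i) x <->
  annihilator (derived_algebra G (subgroup_lie_algebra i)) (mu x).
Proof.
move=> _ _ He Ha Hs Hm Hmu Hi.
apply: iff_trans (iff_sym (annihilator_linear_span _ _)).
have wE X Y := symplectic_fundamental_fields_bracket X Y x He Ha Hm Hmu.
split=> [iso _ [X [Y [lX lY ->]]]|ann _ [_ [h _ <-] <-] _ _ [X lX <-] [Y lY <-]].
  rewrite -wE; apply: (iso x); [|by exists X|by exists Y].
  exists 1%g; last by have [-> _ _] := Ha.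
  by exists 1%g => //; exact: subgroup_hom1.
rewrite !(fundamental_field_act He Ha) Hs wE; apply: ann.
rewrite -(subgroup_homV Hi).
exists (Ad (i h^-1%g) X), (Ad (i h^-1%g) Y).
by split; [exact: Ad_subgroup|exact: Ad_subgroup|].
Qed.
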